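(* Let $\Omega\subset\mathbb R^n$ be open and $t_1<t_2$. For each $(x,t)\in\Omega\times(t_1,t_2)$ let $\mathbb A_{x,t}$ be a nonempty collection of nonempty subsets of $\mathbb S^n_+(\mathbb R)\times(0,\infty)$ such that $\bigcup\mathbb A_{x,t}=\{(A,b):(A,b)\in\mathcal A\text{ for some }\mathcal A\in\mathbb A_{x,t}\}$ is bounded, and define $$F(x,t,z,M)=\sup_{\mathcal A\in\mathbb A_{x,t}}\inf_{(A,b)\in\mathcal A}\big\{\operatorname{trace}(A^tMA)-b\,z\big\},\qquad z\in\mathbb R,\ M\in\mathbb S^n(\mathbb R).$$ A function $u\in C(\Omega\times(t_1,t_2))$ is a viscosity solution of $F(x,t,\partial_tu,D^2u)=0$ in $\Omega\times(t_1,t_2)$ if and only if $$u(x,t)=\sup_{\mathcal A\in\mathbb A_{x,t}}\inf_{(A,b)\in\mathcal A}\frac{1}{\frac{b}{n+2}\varepsilon^2}\int_{t-\frac{b}{n+2}\varepsilon^2}^{t}\frac{1}{|B_\varepsilon(0)|}\int_{B_\varepsilon(0)}u(x+Ay,s)\,dy\,ds+o(\varepsilon^2)\quad\text{as }\varepsilon\to0$$ in the viscosity sense.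
   Context: $\mathbb S^n(\mathbb R)$ is the set of symmetric $n\times n$ real matrices and $\mathbb S^n_+(\mathbb R)$ the positive semidefinite ones. $C^{2,1}$ denotes functions twice continuously differentiable in $x$ and continuously differentiable in $t$. For a constant $c$ and function $g$, ''$c\le g(\varepsilon)+o(\varepsilon^2)$'' means $\lim_{\varepsilon\to0}[c-g(\varepsilon)]^+/\varepsilon^2=0$ and ''$c\ge g(\varepsilon)+o(\varepsilon^2)$'' means $\lim_{\varepsilon\to0}[c-g(\varepsilon)]^-/\varepsilon^2=0$. Viscosity solution: $u$ continuous is a viscosity solution of $F(x,t,\partial_tu,D^2u)=0$ if for every $(x,t)\in\Omega\times(t_1,t_2)$ and every $\phi\in C^{2,1}$: (i) if $u-\phi$ has a strict local maximum at $(x,t)$ with $u(x,t)=\phi(x,t)$, then $F(x,t,\partial_t\phi(x,t),D^2\phi(x,t))\ge0$; (ii) if $u-\phi$ has a strict local minimum at $(x,t)$ with $u(x,t)=\phi(x,t)$, then $F(x,t,\partial_t\phi(x,t),D^2\phi(x,t))\le0$. Asymptotic formula in the viscosity sense: writing it as $u(x,t)=M_\varepsilon[u](x,t)+o(\varepsilon^2)$ with $M_\varepsilon[v](x,t)$ the right-hand side sup-inf of averages, it holds in the viscosity sense if for every $(x,t)$ and every $\phi\in C^{2,1}$: (i) if $u-\phi$ has a strict local minimum at $(x,t)$ with $u(x,t)=\phi(x,t)$, then $0\ge-\phi(x,t)+M_\varepsilon[\phi](x,t)+o(\varepsilon^2)$; (ii) if $u-\phi$ has a strict local maximum at $(x,t)$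 with $u(x,t)=\phi(x,t)$, then $0\le-\phi(x,t)+M_\varepsilon[\phi](x,t)+o(\varepsilon^2)$. *)

(* Defs.v *)
From HB Require Import structures.
From mathcomp Require Import all_boot all_order all_algebra.
From mathcomp Require Import all_classical all_reals all_analysis.
Set Implicit Arguments. Unset Strict Implicit. Unset Printing Implicit Defensive.
Import Order.TTheory GRing.Theory Num.Theory.
Import numFieldNormedType.Exports.
Local Open Scope classical_set_scope.
Local Open Scope ring_scope.

Section Defs.
Context {R : realType} {n : nat}.

Definition psd (A : 'M[R]_n) : Prop :=
  A^T = A /\ forall v : 'rV[R]_n, 0 <= (v *m A *m v^T) 0 0.

(* Lebesgue integral over R^n, as the iterated one-dimensional Lebesgue
   integral (Fubini); x = (x_0, ..., x_{n-1}) *)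
Fixpoint intRn (m : nat) : ('rV[R]_m -> R) -> R :=
  match m with
  | 0 => fun f => f 0
  | m'.+1 => fun f =>
      Rintegral (@lebesgue_measure R) setT
        (fun a => intRn (fun v : 'rV[R]_m' =>
           f (\row_(i < m'.+1) match unlift ord0 i with
                             | Some j => v 0 j | None => a end)))
  end.

Definition eball (e : R) : set 'rV[R]_n :=
  [set y | \sum_(i < n) y 0 i ^+ 2 < e ^+ 2].

Definition ballavg (e : R) (g : 'rV[R]_n -> R) : R :=
  intRn (fun y => \1_(eball e) y * g y) / intRn (fun y => \1_(eball e) y).

Definition evec (i : 'I_n) : 'rV[R]_n := delta_mx 0 i.

Definition dx (i : 'I_n) (phi : 'rV[R]_n -> R -> R) : 'rV[R]_n -> R -> R :=
  fun x t => 'D_(evec i) (fun y => phi y t) x.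
Definition dt (phi : 'rV[R]_n -> R -> R) : 'rV[R]_n -> R -> R :=
  fun x t => 'D_1 (phi x) t.

Definition D2 (phi : 'rV[R]_n -> R -> R) (x : 'rV[R]_n) (t : R) : 'M[R]_n :=
  \matrix_(i, j) dx i (dx j phi) x t.

Definition C21 (phi : 'rV[R]_n -> R -> R) : Prop :=
  continuous (fun p : 'rV[R]_n * R => phi p.1 p.2) /\
  (forall i x t, derivable (fun y => phi y t) x (evec i)) /\
  (forall i j x t, derivable (fun y => dx j phi y t) x (evec i)) /\
  (forall x t, derivable (phi x) t 1) /\
  (forall i, continuous (fun p : 'rV[R]_n * R => dx i phi p.1 p.2)) /\
  (forall i j, continuous (fun p : 'rV[R]_n * R => dx i (dx j phi) p.1 p.2)) /\
  continuous (fun p : 'rV[R]_n * R => dt phi p.1 p.2).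

Definition in_dom (Om : set 'rV[R]_n) (t1 t2 : R) (x : 'rV[R]_n) (t : R) :=
  Om x /\ t1 < t < t2.

Definition strict_lmax (Om : set 'rV[R]_n) (t1 t2 : R)
    (w : 'rV[R]_n -> R -> R) (x : 'rV[R]_n) (t : R) : Prop :=
  exists2 r : R, 0 < r & forall y s, in_dom Om t1 t2 y s ->
    `|y - x| < r -> `|s - t| < r -> (y, s) <> (x, t) -> w y s < w x t.
Definition strict_lmin (Om : set 'rV[R]_n) (t1 t2 : R)
    (w : 'rV[R]_n -> R -> R) (x : 'rV[R]_n) (t : R) : Prop :=
  exists2 r : R, 0 < r & forall y s, in_dom Om t1 t2 y s ->
    `|y - x| < r -> `|s - t| < r -> (y, s) <> (x, t) -> w x t < w y s.

Definition collection := 'rV[R]_n -> R -> set (set ('M[R]_n * R)).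

Definition Fop (AA : collection) (x : 'rV[R]_n) (t z : R) (M : 'M[R]_n) : R :=
  sup [set inf [set \tr (p.1^T *m M *m p.1) - p.2 * z | p in Aset]
      | Aset in AA x t].

Definition Meps (AA : collection) (v : 'rV[R]_n -> R -> R)
    (x : 'rV[R]_n) (t e : R) : R :=
  sup [set inf [set
        let h := p.2 / (n%:R + 2) * e ^+ 2 in
        h^-1 * Rintegral (@lebesgue_measure R) [set s | t - h <= s <= t]
          (fun s => ballavg e (fun y => v (x + y *m p.1^T) s))
       | p in Aset] | Aset in AA x t].

Definition viscosity_solution (F : 'rV[R]_n -> R -> R -> 'M[R]_n -> R)
    (Om : set 'rV[R]_n) (t1 t2 : R) (u : 'rV[R]_n -> R -> R) : Prop :=
  {within [set p : 'rV[R]_n * R | in_dom Om t1 t2 p.1 p.2],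
     continuous (fun p => u p.1 p.2)} /\
  forall x t, in_dom Om t1 t2 x t -> forall phi, C21 phi ->
    (strict_lmax Om t1 t2 (fun y s => u y s - phi y s) x t -> u x t = phi x t ->
       0 <= F x t (dt phi x t) (D2 phi x t)) /\
    (strict_lmin Om t1 t2 (fun y s => u y s - phi y s) x t -> u x t = phi x t ->
       F x t (dt phi x t) (D2 phi x t) <= 0).

Definition asymptotic_viscosity (AA : collection)
    (Om : set 'rV[R]_n) (t1 t2 : R) (u : 'rV[R]_n -> R -> R) : Prop :=
  forall x t, in_dom Om t1 t2 x t -> forall phi, C21 phi ->
    (* (i) 0 >= -phi + M_e[phi] + o(e^2) : [0 - g(e)]^- / e^2 -> 0 *)
    (strict_lmin Om t1 t2 (fun y s => u y s - phi y s) x t -> u x t = phi x t ->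
       (fun e => Num.max (Meps AA phi x t e - phi x t) 0 / e ^+ 2)
         @ (0 : R)^'+ --> (0 : R)) /\
    (* (ii) 0 <= -phi + M_e[phi] + o(e^2) : [0 - g(e)]^+ / e^2 -> 0 *)
    (strict_lmax Om t1 t2 (fun y s => u y s - phi y s) x t -> u x t = phi x t ->
       (fun e => Num.max (phi x t - Meps AA phi x t e) 0 / e ^+ 2)
         @ (0 : R)^'+ --> (0 : R)).

End Defs.

(* Main.v *)
Require Import Defs.
From HB Require Import structures.
From mathcomp Require Import all_boot all_order all_algebra.
From mathcomp Require Import all_classical all_reals all_analysis.
From mathcomp Require Import ring lra.
Import Order.TTheory GRing.Theory Num.Theory.
Import numFieldNormedType.Exports.
Local Open Scope classical_set_scope.
Local Open Scope ring_scope.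

(** For a test function [phi] of class C^{2,1}, Taylor expansion gives, uniformly
    over bounded families of pairs [(A, b)],
      average of [phi (x + A y) s]
        = phi x t + e^2 / (2 (n + 2)) * (tr (A^T D^2phi A) - b d_t phi) + o(e^2):
    the first-order term in [y] averages to zero, [y_i y_j] averages to
    [delta_ij e^2 / (n + 2)] and [s - t] to [- b e^2 / (2 (n + 2))].  The sup-inf is
    monotone and commutes with increasing affine maps, hence
    [(M_e[phi] - phi) / e^2] tends to [F / (2 (n + 2))], and each one-sided
    asymptotic inequality is equivalent to the sign condition on [F].

    Measurability of the slices of [phi] in the iterated integral never matters:
    the integral is monotone on all functions, so the averages are squeezed
    between averages of quadratic polynomials, which are computed explicitly. *)

(** * Monotonicity and bounds of the integral without measurability of the integrand *)

Section integral_monotone.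
Context {d : measure_display} {T : measurableType d} {R : realType}
  (mu : {measure set T -> \bar R}).

(** The integral is a difference of suprema over the simple functions lying below the positive and
    the negative part. Enlarging the integrand enlarges the first family and shrinks the second,
    whether or not the integrand is measurable. *)
Lemma le_integral_nonmeasurable (D : set T) (f g : T -> \bar R) :
  (forall x, D x -> (f x <= g x)%E) ->
  (\int[mu]_(x in D) f x <= \int[mu]_(x in D) g x)%E.
Proof.
move=> fg; have fgD x : ((f \_ D) x <= (g \_ D) x)%E.
  by rewrite !patchE; case: ifPn => //; rewrite inE => /fg.
rewrite /integral; apply: leeB; apply: ereal_sup_le => _ [h /= hf <-];
  exists h => //= x; apply: le_trans (hf x) _.
- by rewrite !funeposE ge_max !le_max lexx orbT andbT fgD.
- by rewrite !funenegE ge_max !le_max lexx orbT andbT leeN2 fgD.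
Qed.

(** [Rintegral] passes through [fine], which sends infinite values to 0 and is monotone only on
    finite ones; comparing with constants gives the finiteness. *)
Lemma integral_bounded_fin_num (D : set T) (f : T -> R) (K : R) :
  measurable D -> (mu D < +oo)%E -> (forall x, D x -> `|f x| <= K) ->
  (\int[mu]_(x in D) (f x)%:E)%E \is a fin_num.
Proof.
move=> mD Doo fK.
have fD : mu D \is a fin_num by rewrite ge0_fin_numE.
have up : (\int[mu]_(x in D) (f x)%:E <= K%:E * mu D)%E.
  rewrite -integral_cst//; apply: le_integral_nonmeasurable => x Dx.
  by rewrite lee_fin (le_trans (ler_norm _) (fK x Dx)).
have lo : ((- K)%:E * mu D <= \int[mu]_(x in D) (f x)%:E)%E.
  rewrite -integral_cst//; apply: le_integral_nonmeasurable => x Dx.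
  by rewrite lee_fin; have := fK x Dx; rewrite ler_norml => /andP[].
rewrite fin_numElt; apply/andP; split.
- by apply: lt_le_trans lo; rewrite ltNye_eq fin_numM.
- by apply: le_lt_trans up _; rewrite ltey_eq fin_numM.
Qed.

Lemma le_Rintegral_bounded (D : set T) (f g : T -> R) (K K' : R) :
  measurable D -> (mu D < +oo)%E ->
  (forall x, D x -> `|f x| <= K) -> (forall x, D x -> `|g x| <= K') ->
  (forall x, D x -> f x <= g x) ->
  Rintegral mu D f <= Rintegral mu D g.
Proof.
move=> mD Doo fK gK fg; apply: fine_le.
- exact: integral_bounded_fin_num fK.
- exact: integral_bounded_fin_num gK.
- by apply: le_integral_nonmeasurable => x Dx; rewrite lee_fin fg.
Qed.

Lemma normr_Rintegral_bounded (D : set T) (f : T -> R) (K : R) :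
  measurable D -> (mu D < +oo)%E -> (forall x, D x -> `|f x| <= K) ->
  `|Rintegral mu D f| <= K * fine (mu D).
Proof.
move=> mD Doo fK; rewrite ler_norml -mulNr -!Rintegral_cst//.
have cK (c : R) x : D x -> `|c| <= `|c| by [].
by apply/andP; split; apply: le_Rintegral_bounded => //;
  do ?[exact: fK|exact: cK] => x Dx; have := fK x Dx; rewrite ler_norml => /andP[].
Qed.

End integral_monotone.

(** * Moments of the chords of a disc *)

Section one_dim.
Context {R : realType}.
Notation mu := (@lebesgue_measure R).

Lemma continuous_integrable_itv (f : R -> R) (a b : R) :
  continuous f -> mu.-integrable `[a, b] (EFin \o f).
Proof.
move=> cf; apply: continuous_compact_integrable; first exact: segment_compact.
exact: continuous_subspaceT.
Qed.

Lemma Rintegral_FTC2 (f F : R -> R) (a b : R) : a < b ->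
  continuous f -> continuous F ->
  (forall x, a < x < b -> is_derive x 1 F (f x)) ->
  Rintegral mu `[a, b] f = F b - F a.
Proof.
move=> ab cf cF dF.
rewrite /Rintegral (@continuous_FTC2 _ f F)//.
- exact: continuous_subspaceT.
- split => [x||]; do ?by [apply: cvg_at_right_filter; apply: cF|
    apply: cvg_at_left_filter; apply: cF].
  by rewrite in_itv/= => xab; have [] := dF x xab.
- move=> x; rewrite in_itv/= => xab; rewrite derive1E.
  by have ? := dF x xab; exact: derive_val.
Qed.

Lemma is_derive1M (f g : R -> R) (x df dg : R) :
  is_derive x 1 f df -> is_derive x 1 g dg ->
  is_derive x 1 (fun y => f y * g y) (df * g x + f x * dg).
Proof.
move=> df1 dg1; have D := is_deriveM df1 dg1.
by rewrite addrC (mulrC df).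
Qed.

Lemma is_derive1B (f g : R -> R) (x df dg : R) :
  is_derive x 1 f df -> is_derive x 1 g dg ->
  is_derive x 1 (fun y => f y - g y) (df - dg).
Proof. by move=> df1 dg1; exact: (is_deriveB df1 dg1). Qed.

Lemma is_derive1D (f g : R -> R) (x df dg : R) :
  is_derive x 1 f df -> is_derive x 1 g dg ->
  is_derive x 1 (fun y => f y + g y) (df + dg).
Proof. by move=> df1 dg1; exact: (is_deriveD df1 dg1). Qed.

Lemma is_derive1_quad (c k l x : R) :
  is_derive x 1 (fun a => c + k * a + l * a ^+ 2) (k + 2 * l * x).
Proof.
have dc (b : R) : is_derive x 1 (fun=> b : R) 0 by exact: is_derive_cst.
have di : is_derive x 1 (fun a : R => a) 1 by exact: is_derive_id.
have D := is_derive1D _ _ _ _ _ (is_derive1D _ _ _ _ _ (dc c)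
  (is_derive1M _ _ _ _ _ (dc k) di))
  (is_derive1M _ _ _ _ _ (dc l) (is_derive1M _ _ _ _ _ di di)).
rewrite (_ : k + _ = 0 + (0 * x + k * 1) + (0 * (x * x) + l * (1 * x + x * 1))).
  exact: D.
by ring.
Qed.

(** Radius of the slice of the ball of radius [r] where the first coordinate equals [a]. Since
    [Num.sqrt] is 0 on negative reals, it vanishes for [a] outside the ball and is continuous
    everywhere. *)
Definition halfchord (r a : R) := Num.sqrt (r ^+ 2 - a ^+ 2).

Lemma halfchord_continuous r : continuous (halfchord r).
Proof.
move=> x; rewrite (_ : halfchord r = Num.sqrt \o (fun a => r ^+ 2 - a ^+ 2))//.
apply: continuous_comp.
  by apply: cvgB; [exact: cvg_cst|exact: exprn_continuous].
exact: sqrt_continuous.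
Qed.

Lemma halfchordX_continuous r m : continuous (fun a => halfchord r a ^+ m).
Proof.
move=> x; rewrite (_ : (fun _ => _) = (fun y => y ^+ m) \o halfchord r)//.
apply: continuous_comp.
  exact: halfchord_continuous.
exact: exprn_continuous.
Qed.

(** With an exponent of at least 2, the factor [1 / halfchord r a] from the square root is absorbed,
    so no negative power remains. *)
Lemma is_derive_halfchordX (r a : R) (m : nat) : - r < a < r ->
  is_derive a 1 (fun a => halfchord r a ^+ m.+2)
    (- (m.+2%:R * a * halfchord r a ^+ m)).
Proof.
move=> ar; have p0 : 0 < r ^+ 2 - a ^+ 2 by nra.
have w0 : halfchord r a != 0 by rewrite gt_eqF// sqrtr_gt0.
have ds := is_derive1_sqrt p0.
have di : is_derive a 1 (fun a : R => r ^+ 2 - a ^+ 2) (- (2 * a)).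
  rewrite (_ : (fun _ => _) = cst (r ^+ 2) - id ^+ 2).
    by apply: is_derive_eq; rewrite sub0r scaler1 expr1.
  by apply/funext => y; rewrite -[RHS]/(r ^+ 2 - (id ^+ 2) y) exprfctE.
have dw : is_derive a 1 (halfchord r) ((2 * halfchord r a)^-1 * - (2 * a)).
  exact: is_derive1_comp.
rewrite (_ : (fun _ => _) = halfchord r ^+ m.+2); last by rewrite exprfctE.
apply: is_derive_eq; rewrite -[_ *: _]/(_ * _) /= exprS.
by field.
Qed.

(** Up to the volume of the unit ball in dimension [m], this is the volume of the ball of radius [r]
    in dimension [m + 1], computed by slices. *)
Definition capint (m : nat) (r : R) :=
  Rintegral mu `[(- r), r] (fun a => halfchord r a ^+ m).

(* The linear part of the integrand, and any multiple of
   [r^2 - (m + 3) a^2], have antiderivatives vanishing at both ends: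
   [halfchord r a ^+ m.+2] and [a * halfchord r a ^+ m.+2] up to constants. *)
Lemma Rintegral_halfchord_quad (m : nat) (r al be ga de : R) : 0 < r ->
  Rintegral mu `[(- r), r] (fun a => halfchord r a ^+ m *
    (al + be * a + ga * a ^+ 2 + de * (r ^+ 2 - a ^+ 2))) =
  capint m r * (al + (ga + m.+2%:R * de) * (r ^+ 2 / m.+3%:R)).
Proof.
(* [K] is the constant for which the bracket minus [K] equals [be * a] plus a multiple of
   [r ^+ 2 - m.+3%:R * a ^+ 2]. *)
move=> r0; set K := al + _.
pose w := halfchord r.
pose F := fun a : R => (- be / m.+2%:R + (de - ga) / m.+3%:R * a) * w a ^+ m.+2.
pose f := fun a : R =>
  w a ^+ m * (be * a + (de - ga) / m.+3%:R * (r ^+ 2 - m.+3%:R * a ^+ 2)).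
have cpoly (b c d : R) : continuous (fun a : R => b + c * a + d * a ^+ 2).
  move=> x; apply: cvgD; first apply: cvgD; first exact: cvg_cst.
    by apply: cvgM; [exact: cvg_cst|exact: cvg_id].
  by apply: cvgM; [exact: cvg_cst|exact: exprn_continuous].
have cw k : continuous (fun a => w a ^+ k) by exact: halfchordX_continuous.
have m2 : m.+2%:R != 0 :> R by rewrite pnatr_eq0.
have m3 : m.+3%:R != 0 :> R by rewrite pnatr_eq0.
have cF : continuous F.
  rewrite (_ : F = fun a =>
    (- be / m.+2%:R + (de - ga) / m.+3%:R * a + 0 * a ^+ 2) * w a ^+ m.+2).
    by move=> x; apply: cvgM; [exact: cpoly|exact: cw].
  by apply/funext => a; rewrite mul0r addr0.
have cf : continuous f.
  rewrite (_ : f = fun a => w a ^+ m *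
    ((de - ga) / m.+3%:R * r ^+ 2 + be * a + (ga - de) * a ^+ 2)).
    by move=> x; apply: cvgM; [exact: cw|exact: cpoly].
  by apply/funext => a; rewrite /f; congr (_ * _); field.
have If0 : Rintegral mu `[(- r), r] f = 0.
  have dF x : - r < x < r -> is_derive x 1 F (f x).
    move=> xr; have dw := @is_derive_halfchordX r x m xr.
    have x2 : x ^+ 2 <= r ^+ 2 by nra.
    have D := is_derive1M _ _ _ _ _
      (is_derive1_quad (- be / m.+2%:R) ((de - ga) / m.+3%:R) 0 x) dw.
    rewrite (_ : F = fun a => (- be / m.+2%:R + (de - ga) / m.+3%:R * a + 0 * a ^+ 2) *
      halfchord r a ^+ m.+2); last by apply/funext => a; rewrite mul0r addr0.
    suff -> : f x = ((de - ga) / m.+3%:R + 2 * 0 * x) * w x ^+ m.+2 +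
        (- be / m.+2%:R + (de - ga) / m.+3%:R * x + 0 * x ^+ 2) *
        - (m.+2%:R * x * w x ^+ m) by exact: D.
    have -> : w x ^+ m.+2 = w x ^+ m * (r ^+ 2 - x ^+ 2).
      by rewrite /w -addn2 exprD sqr_sqrtr// subr_ge0.
    by rewrite /f -/(w x); move: m2 m3; rewrite -!natr1 => m2 m3; field; apply/andP.
  have rr : - r < r by rewrite gtrN.
  rewrite (Rintegral_FTC2 _ _ _ _ rr cf cF dF).
  by rewrite /F /w /halfchord sqrrN subrr sqrtr0 !expr0n/= !mulr0 subrr.
rewrite (_ : (fun a => _) = fun a => w a ^+ m * K + f a); last first.
  by apply/funext => a; rewrite /f -/w -mulrDr /K; congr (_ * _); field.
rewrite RintegralD//; last 2 first.
- by apply: continuous_integrable_itv => x; apply: cvgM; [exact: cw|exact: cvg_cst].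
- exact: continuous_integrable_itv.
rewrite If0 addr0 RintegralZr//.
exact: continuous_integrable_itv.
Qed.

(** Substitute [r * a] for [a]: the integrand contributes [r ^+ m] by homogeneity of the half chord,
    and the measure one more factor [r]. *)
Lemma capint_scale (m : nat) (r : R) : 0 < r ->
  capint m r = capint m 1 * r ^+ m.+1.
Proof.
move=> r0; rewrite /capint.
pose F := fun a : R => r * a.
have dF (x : R) : is_derive x 1 F r.
  by rewrite (_ : F = r *: id)//; apply: is_derive_eq; rewrite -[_ *: _]/(_ * _) mulr1.
have F'E : derive1 F = cst r.
  by apply/funext => x; rewrite derive1E; apply: derive_val.
have cF : continuous F by move=> x; apply: cvgM; [exact: cvg_cst|exact: cvg_id].
rewrite -RintegralZr//; last exact/continuous_integrable_itv/halfchordX_continuous.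
have -> : `[- r, r]%classic = `[F (- 1), F 1]%classic by rewrite /F mulrN1 mulr1.
rewrite /Rintegral integration_by_substitution_increasing//.
- congr fine; apply: eq_integral => x _ /=; rewrite F'E; congr EFin.
  rewrite -[LHS]/(halfchord r (r * x) ^+ m * r) exprSr mulrA; congr (_ * _).
  rewrite -exprMn; congr (_ ^+ _).
  rewrite /halfchord expr1n exprMn -{1}[r ^+ 2]mulr1 -mulrBr sqrtrM ?sqr_ge0//.
  by rewrite sqrtr_sqr gtr0_norm// mulrC.
- by move=> x y _ _; rewrite /F ltr_pM2l.
- by move=> x _; rewrite F'E; exact: cvg_cst.
- by rewrite F'E; exact: is_cvg_cst.
- by rewrite F'E; exact: is_cvg_cst.
- split => [x _||]; [by have [] := dF x|exact/cvg_at_right_filter/cF|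
    exact/cvg_at_left_filter/cF].
- exact/continuous_subspaceT/halfchordX_continuous.
Qed.

Lemma lebesgue_measure_itvcc_fin (a b : R) : (mu `[a, b] < +oo)%E.
Proof. by rewrite lebesgue_measure_itv/=; case: ifP; rewrite ltry. Qed.

(** On the middle half of the interval the half chord is at least 1/2, so the integral is at least
    [2^-1 ^+ m]. *)
Lemma capint1_gt0 (m : nat) : 0 < capint m 1.
Proof.
pose P : set R := `[- 2^-1, 2^-1]%classic.
apply: (@lt_le_trans _ _ (2^-1 ^+ m)); first by rewrite exprn_gt0// invr_gt0.
have -> : 2^-1 ^+ m = Rintegral mu `[(-1), 1] ((fun=> 2^-1 ^+ m : R) \_ P).
  rewrite -Rintegral_mkcondr setIidr//; last first.
    by move=> x; rewrite /P/= !in_itv/= => /andP[? ?]; apply/andP; split; lra.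
  rewrite Rintegral_cst /P// [X in fine X]lebesgue_measure_itv/= lte_fin.
  rewrite ifT; last by lra.
  by rewrite /= opprK (_ : 2^-1 + 2^-1 = 1) ?mulr1//; lra.
apply: (@le_Rintegral_bounded _ _ _ _ _ _ _ (2^-1 ^+ m) 1) => //.
- exact: lebesgue_measure_itvcc_fin.
- move=> x _; rewrite patchE; case: ifP => _; last by rewrite normr0 exprn_ge0.
  by rewrite ger0_norm// exprn_ge0.
- move=> x _; rewrite ger0_norm ?exprn_ge0 ?sqrtr_ge0// exprn_ile1 ?sqrtr_ge0//.
  by rewrite -[leRHS]sqrtr1 ler_wsqrtr// expr1n gerBl sqr_ge0.
- move=> x _; rewrite patchE; case: ifPn; last by rewrite exprn_ge0 ?sqrtr_ge0.
  rewrite inE /P/= in_itv/= => /andP[? ?].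
  apply: lerXn2r; rewrite ?nnegrE ?sqrtr_ge0 ?invr_ge0//.
  rewrite -[leLHS]gtr0_norm ?invr_gt0// -sqrtr_sqr ler_wsqrtr//.
  nra.
Qed.
End one_dim.

(** * Quadratic polynomials on balls *)

Section ball_moments.
Context {R : realType}.
Notation mu := (@lebesgue_measure R).

(** Volume of the unit ball, obtained by slicing off one coordinate at a time. *)
Fixpoint ballvol (m : nat) : R :=
  if m is m'.+1 then ballvol m' * capint m' 1 else 1.

Lemma ballvol_gt0 m : 0 < ballvol m.
Proof. by elim: m => //= m IH; rewrite mulr_gt0// capint1_gt0. Qed.

Definition quadpoly (m : nat) (c : R) (b : 'I_m -> R) (q : 'I_m -> 'I_m -> R)
    (y : 'rV[R]_m) : R :=
  c + \sum_i b i * y 0 i + \sum_i \sum_j q i j * y 0 i * y 0 j.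

(** Induction on the dimension by slices. The squared radius [rho] is the parameter because the
    slice at [a] has squared radius [rho - a ^+ 2]; the [if] makes the formula hold for empty slices
    too. *)
Lemma intRn_ball_quadpoly m (rho c : R) b q :
  intRn (fun y : 'rV[R]_m =>
    (\sum_i y 0 i ^+ 2 < rho)%R%:R * quadpoly m c b q y) =
  (if 0 < rho then ballvol m * Num.sqrt rho ^+ m else 0) *
  (c + (\sum_i q i i) * (rho / (m%:R + 2))).
Proof.
elim: m => [|m IH] in rho c b q *.
  rewrite /= /quadpoly !big_ord0 !addr0 mul0r addr0.
  by case: ifP; rewrite ?mul1r ?mul0r ?expr0.
rewrite /=.
pose e (a : R) (v : 'rV[R]_m) : 'rV[R]_m.+1 :=
  \row_i match unlift ord0 i with Some j => v 0 j | None => a end.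
have e0 a v : e a v 0 ord0 = a by rewrite mxE unlift_none.
have eS a v i : e a v 0 (lift ord0 i) = v 0 i by rewrite mxE liftK.
pose s : R := \sum_i q (lift ord0 i) (lift ord0 i).
have slice a : intRn (fun v =>
    (\sum_i e a v 0 i ^+ 2 < rho)%R%:R * quadpoly m.+1 c b q (e a v)) =
  (if 0 < rho - a ^+ 2 then ballvol m * Num.sqrt (rho - a ^+ 2) ^+ m else 0) *
  (c + b ord0 * a + q ord0 ord0 * a ^+ 2 + s / (m%:R + 2) * (rho - a ^+ 2)).
  (* With the first coordinate frozen at [a], the cross terms join the linear coefficients, which do
     not appear in the value given by the induction hypothesis. *)
  transitivity (intRn (fun y : 'rV[R]_m => (\sum_i y 0 i ^+ 2 < rho - a ^+ 2)%R%:R *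
    quadpoly m (c + b ord0 * a + q ord0 ord0 * a ^+ 2)
     (fun i => b (lift ord0 i) + (q ord0 (lift ord0 i) + q (lift ord0 i) ord0) * a)
     (fun i j => q (lift ord0 i) (lift ord0 j)) y)); last first.
    by rewrite IH -/s; congr (_ * (_ + _)); rewrite mulrAC mulrA.
  congr intRn; apply/funext => v; rewrite big_ord_recl e0.
  under eq_bigr do rewrite eS.
  rewrite ltrBrDl; congr (_ * _); rewrite /quadpoly.
  have lin : \sum_i b i * e a v 0 i =
      b ord0 * a + \sum_i b (lift ord0 i) * v 0 i.
    by rewrite big_ord_recl e0; under eq_bigr do rewrite eS.
  have quad i : \sum_j q i j * e a v 0 i * e a v 0 j =
      q i ord0 * e a v 0 i * a + \sum_j q i (lift ord0 j) * e a v 0 i * v 0 j.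
    by rewrite big_ord_recl e0; under eq_bigr do rewrite eS.
  under [X in _ + X = _]eq_bigr do rewrite quad.
  rewrite lin big_split !big_ord_recl /= e0.
  under [X in _ + (_ + X + _)]eq_bigr do rewrite eS.
  under [X in _ + (_ + (_ + X))]eq_bigr do under eq_bigr do rewrite eS.
  under [X in _ = _ + X + _]eq_bigr do rewrite mulrDl mulrDl mulrDl.
  rewrite !big_split /=.
  under [X in _ + (_ + X + _)]eq_bigr do rewrite mulrAC.
  by rewrite expr2; ring.
rewrite (_ : (fun a => _) = fun a =>
  (if 0 < rho - a ^+ 2 then ballvol m * Num.sqrt (rho - a ^+ 2) ^+ m else 0) *
  (c + b ord0 * a + q ord0 ord0 * a ^+ 2 + s / (m%:R + 2) * (rho - a ^+ 2)));
  last by apply/funext => a; rewrite -slice.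
rewrite big_ord_recl -/s.
have [rho0|rho0] := ltP 0 rho; last first.
  rewrite mul0r (_ : (fun a => _) = cst 0).
    by rewrite Rintegral_cst// mul0r.
  by apply/funext => a; rewrite ifF ?mul0r//; apply/negbTE; rewrite -leNgt; nra.
set r := Num.sqrt rho.
have r0 : 0 < r by rewrite sqrtr_gt0.
have rE : rho = r ^+ 2 by rewrite sqr_sqrtr// ltW.
pose g a := halfchord r a ^+ m *
    (c + b ord0 * a + q ord0 ord0 * a ^+ 2 + s / (m%:R + 2) * (r ^+ 2 - a ^+ 2)).
have cg : continuous g.
  move=> x; apply: cvgM; first exact: halfchordX_continuous.
  apply: cvgD; first apply: cvgD; first apply: cvgD; first exact: cvg_cst.
  - by apply: cvgM; [exact: cvg_cst|exact: cvg_id].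
  - by apply: cvgM; [exact: cvg_cst|exact: exprn_continuous].
  - apply: cvgM; first exact: cvg_cst.
    by apply: cvgB; [exact: cvg_cst|exact: exprn_continuous].
have ig := continuous_integrable_itv _ (- r) r cg.
(* The slice is nonempty exactly on the open interval; its endpoints are null and are added next, to
   reach the closed interval of the chord formula. *)
transitivity (Rintegral mu `]- r, r[ (fun a => ballvol m * g a)).
  rewrite [RHS]Rintegral_mkcond; apply: eq_Rintegral => a _.
  rewrite patchE mem_setE in_itv/= rE.
  have -> : (0 < r ^+ 2 - a ^+ 2) = (- r < a < r).
    rewrite subr_gt0 -ltr_sqrt ?exprn_gt0// !sqrtr_sqr (gtr0_norm r0).
    by rewrite ltr_norml.
  by case: ifP => _; rewrite ?mul0r// -mulrA.
have ig' : mu.-integrable `[- r, r] (EFin \o (fun a => ballvol m * g a)).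
  by apply: continuous_integrable_itv => x; apply: cvgM; [exact: cvg_cst|exact: cg].
rewrite Rintegral_itv_bndo_bndc; last first.
  by apply: integrableS ig' => //; apply: subset_itvScc; rewrite bnd_simp.
rewrite Rintegral_itv_obnd_cbnd; last first.
  by apply: integrableS ig' => //; apply: subset_itvScc; rewrite bnd_simp.
(* Here the coefficient of [r ^+ 2 - a ^+ 2] is [s / (m%:R + 2)]. The factor [m.+2%:R] in the chord
   formula cancels its denominator, so [q ord0 ord0 + s] is the full trace. *)
rewrite RintegralZl// Rintegral_halfchord_quad// capint_scale//.
rewrite rE; have m2 : m%:R + 2 != 0 :> R by rewrite -natrD pnatr_eq0 addn2.
have m3 : m%:R + 3 != 0 :> R by rewrite -natrD pnatr_eq0 addn3.
have E3 : m.+3%:R = m%:R + 3 :> R by rewrite -addn3 natrD.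
have E2 : m.+2%:R = m%:R + 2 :> R by rewrite -addn2 natrD.
have E1 : m.+1%:R = m%:R + 1 :> R by rewrite -addn1 natrD.
rewrite E3 E2 E1 -[m%:R + 1 + 2]addrA (_ : 1 + 2 = 3 :> R); last by ring.
by field; rewrite m2 m3.
Qed.
End ball_moments.

(** * Monotonicity of the iterated integral on bounded functions of bounded support *)

Section intRn_monotone.
Context {R : realType}.
Notation mu := (@lebesgue_measure R).

Lemma Rintegral_bounded_support (F : R -> R) (L : R) :
  (forall a, L < `|a| -> F a = 0) ->
  Rintegral mu setT F = Rintegral mu `[- L, L] F.
Proof.
move=> F0; rewrite [RHS]Rintegral_mkcond; apply: eq_Rintegral => a _.
rewrite patchE mem_setE in_itv/= -ler_norml; case: ifPn => //.
by rewrite -ltNge => /F0.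
Qed.

Lemma intRn0 m : intRn (fun _ : 'rV[R]_m => 0) = 0 :> R.
Proof.
by elim: m => //= m IH; under eq_Rintegral do rewrite IH; rewrite Rintegral_cst// mul0r.
Qed.

(** The bound is [K] times the volume of the cube containing the support. It makes inner integrals
    bounded, as one-dimensional monotonicity requires at the next level. *)
Lemma normr_intRn_bounded m (f : 'rV[R]_m -> R) (K L : R) : 0 <= L ->
  (forall y, `|f y| <= K) -> (forall (y : 'rV[R]_m) i, L < `|y 0 i| -> f y = 0) ->
  `|intRn f| <= K * (2 * L) ^+ m.
Proof.
move=> L0; elim: m => [|m IH] in f *.
  by move=> fK _; rewrite expr0 mulr1; exact: fK.
move=> fK f0 /=; rewrite (@Rintegral_bounded_support _ L); last first.
  move=> a La; rewrite (_ : (fun v => _) = (fun=> 0)) ?intRn0//.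
  by apply/funext => v; apply: (f0 _ ord0); rewrite mxE unlift_none.
rewrite exprSr mulrA.
have {2}-> : 2 * L = fine (mu `[- L, L]).
  rewrite lebesgue_measure_itv/= lte_fin; have [L0'|L0'] := ltP (- L) L.
    by rewrite /=; ring.
  by rewrite (_ : L = 0) ?mulr0//; lra.
apply: normr_Rintegral_bounded => //; first exact: lebesgue_measure_itvcc_fin.
move=> a _; apply: IH => [y|y i yi]; first exact: fK.
by apply: (f0 _ (lift ord0 i)); rewrite mxE liftK.
Qed.

Lemma le_intRn m (f g : 'rV[R]_m -> R) (K L : R) : 0 <= L ->
  (forall y, `|f y| <= K) -> (forall (y : 'rV[R]_m) i, L < `|y 0 i| -> f y = 0) ->
  (forall y, `|g y| <= K) -> (forall (y : 'rV[R]_m) i, L < `|y 0 i| -> g y = 0) ->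
  (forall y, f y <= g y) -> intRn f <= intRn g.
Proof.
move=> L0; elim: m => [|m IH] in f g *; first by move=> _ _ _ _ /(_ 0).
move=> fK f0 gK g0 fg /=.
rewrite !(@Rintegral_bounded_support _ L); first last.
- move=> a La; rewrite (_ : (fun v => _) = (fun=> 0)) ?intRn0//.
  by apply/funext => v; apply: (f0 _ ord0); rewrite mxE unlift_none.
- move=> a La; rewrite (_ : (fun v => _) = (fun=> 0)) ?intRn0//.
  by apply/funext => v; apply: (g0 _ ord0); rewrite mxE unlift_none.
apply: (@le_Rintegral_bounded _ _ _ _ _ _ _ (K * (2 * L) ^+ m) (K * (2 * L) ^+ m)) => //.
- exact: lebesgue_measure_itvcc_fin.
- move=> a _; apply: normr_intRn_bounded => // y i yi.
  by apply: (f0 _ (lift ord0 i)); rewrite mxE liftK.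
- move=> a _; apply: normr_intRn_bounded => // y i yi.
  by apply: (g0 _ (lift ord0 i)); rewrite mxE liftK.
- move=> a _; apply: IH => // y i yi.
    by apply: (f0 _ (lift ord0 i)); rewrite mxE liftK.
  by apply: (g0 _ (lift ord0 i)); rewrite mxE liftK.
Qed.

End intRn_monotone.

(** * Averages over balls and time intervals of functions close to polynomials *)

Section averages.
Context {R : realType}.
Notation mu := (@lebesgue_measure R).

Lemma sum_sqr_lt_coord n (y : 'rV[R]_n) (e : R) i : 0 < e ->
  \sum_i y 0 i ^+ 2 < e ^+ 2 -> `|y 0 i| < e.
Proof.
move=> e0 ye; rewrite -(gtr0_norm e0) -ltr_sqr ?nnegrE// !real_normK ?num_real//.
apply: le_lt_trans ye; rewrite (bigD1 i)//= lerDl; apply: sumr_ge0 => j _.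
exact: sqr_ge0.
Qed.

Lemma normr_quadpoly_le n (e c : R) b q (y : 'rV[R]_n) : 0 < e ->
  \sum_i y 0 i ^+ 2 < e ^+ 2 ->
  `|quadpoly n c b q y| <=
    `|c| + \sum_i `|b i| * e + \sum_i \sum_j `|q i j| * e * e.
Proof.
move=> e0 ye; have ylt i : `|y 0 i| <= e by apply/ltW/sum_sqr_lt_coord.
rewrite /quadpoly; apply: le_trans (ler_normD _ _) _; apply: lerD.
  apply: le_trans (ler_normD _ _) _; apply: lerD => //.
  apply: le_trans (ler_norm_sum _ _ _) _; apply: ler_sum => i _.
  by rewrite normrM ler_wpM2l.
apply: le_trans (ler_norm_sum _ _ _) _; apply: ler_sum => i _.
apply: le_trans (ler_norm_sum _ _ _) _; apply: ler_sum => j _.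
by rewrite !normrM ler_pM// ?mulr_ge0// ler_wpM2l.
Qed.

Lemma quadpolyD n (c s : R) b q (y : 'rV[R]_n) :
  quadpoly n (c + s) b q y = quadpoly n c b q y + s.
Proof. by rewrite /quadpoly; ring. Qed.

(** On the ball [g] is squeezed between the polynomials with constant terms [c - d] and [c + d],
    whose averages are explicit and differ from the claimed value by [d]. *)
Lemma ballavg_near_quadpoly n (e c d : R) b q (g : 'rV[R]_n -> R) : 0 < e ->
  (forall y : 'rV[R]_n, \sum_i y 0 i ^+ 2 < e ^+ 2 -> `|g y - quadpoly n c b q y| <= d) ->
  `|ballavg e g - (c + (\sum_i q i i) * (e ^+ 2 / (n%:R + 2)))| <= d.
Proof.
move=> e0 gd; set t := _ * (_ / _).
pose V : R := ballvol n * e ^+ n.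
have V0 : 0 < V by rewrite mulr_gt0 ?ballvol_gt0 ?exprn_gt0.
have e2 : 0 < e ^+ 2 by rewrite exprn_gt0.
have ind (y : 'rV[R]_n) : \1_(eball e) y = ((\sum_i y 0 i ^+ 2 < e ^+ 2)%R)%:R :> R.
  rewrite indicE; congr (_%:R); congr nat_of_bool.
  by apply/idP/idP; rewrite inE.
pose w s (y : 'rV[R]_n) : R := (\sum_i y 0 i ^+ 2 < e ^+ 2)%R%:R * quadpoly n (c + s) b q y.
have intw s : intRn (w s) = V * (c + s + t).
  by rewrite /w intRn_ball_quadpoly e2 sqrtr_sqr gtr0_norm.
(* The volume in the denominator is the integral of the constant polynomial 1. *)
have den : intRn (fun y : 'rV[R]_n => \1_(eball e) y) = V.
  have := intRn_ball_quadpoly n (e ^+ 2) 1 (fun=> 0) (fun _ _ => 0).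
  rewrite e2 sqrtr_sqr gtr0_norm// big1// mul0r addr0 mulr1 -/V => <-.
  congr intRn; apply/funext => y; rewrite ind /quadpoly.
  rewrite [X in 1 + X + _]big1 => [|i _]; last by rewrite mul0r.
  rewrite [X in _ * (_ + X)]big1 => [|i _]; first by rewrite !addr0 mulr1.
  by rewrite big1// => j _; rewrite !mul0r.
pose f (y : 'rV[R]_n) := \1_(eball e) y * g y.
pose K0 := `|c| + \sum_i `|b i| * e + \sum_i \sum_j `|q i j| * e * e.
pose K := K0 + `|d|.
have K0_ge0 : 0 <= K0.
  rewrite !addr_ge0// sumr_ge0// => i _; first by rewrite mulr_ge0// ltW.
  by rewrite sumr_ge0// => j _; rewrite !mulr_ge0// ltW.
have K_ge0 : 0 <= K by rewrite addr_ge0.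
have wK s y : `|s| <= `|d| -> `|w s y| <= K.
  move=> sd; rewrite /w; case: (boolP (_ < _)) => ye; last by rewrite mul0r normr0.
  rewrite mul1r quadpolyD; apply: le_trans (ler_normD _ _) (lerD _ sd).
  exact: normr_quadpoly_le.
have off (h : 'rV[R]_n -> R) (y : 'rV[R]_n) i : e < `|y 0 i| ->
    (\sum_i y 0 i ^+ 2 < e ^+ 2)%R%:R * h y = 0.
  move=> yi; case: (boolP (_ < _)) => [/(@sum_sqr_lt_coord _ _ _ i e0)|];
    last by rewrite mul0r.
  by rewrite ltNge (ltW yi).
have fK y : `|f y| <= K.
  rewrite /f ind; case: (boolP (_ < _)) => ye; last by rewrite mul0r normr0.
  rewrite mul1r -[g y](subrK (quadpoly n c b q y)) addrC.
  apply: le_trans (ler_normD _ _) (lerD _ _); first exact: normr_quadpoly_le.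
  exact: le_trans (gd y ye) (ler_norm _).
have f0 (y : 'rV[R]_n) i : e < `|y 0 i| -> f y = 0 by rewrite /f ind; exact: off.
have up : intRn f <= V * (c + d + t).
  rewrite -intw; apply: (@le_intRn _ _ _ _ K e) => // [|y|y i|y]; first exact: ltW.
  - by rewrite wK.
  - exact: off.
  rewrite /f /w ind; case: (boolP (_ < _)) => ye; rewrite ?mul0r// !mul1r quadpolyD.
  by have := gd y ye; rewrite ler_norml => /andP[]; lra.
have lo : V * (c - d + t) <= intRn f.
  rewrite -intw; apply: (@le_intRn _ _ _ _ K e) => // [|y|y i|y]; first exact: ltW.
  - by rewrite wK// normrN.
  - exact: off.
  rewrite /f /w ind; case: (boolP (_ < _)) => ye; rewrite ?mul0r// !mul1r quadpolyD.
  by have := gd y ye; rewrite ler_norml => /andP[]; lra.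
rewrite /ballavg den -/f ler_norml; apply/andP; split.
  rewrite lerBrDr ler_pdivlMr//; apply: le_trans lo.
  by rewrite le_eqVlt; apply/orP; left; apply/eqP; ring.
rewrite lerBlDr ler_pdivrMr//; apply: (le_trans up).
by rewrite le_eqVlt; apply/orP; left; apply/eqP; ring.
Qed.

(** The same squeeze in time: the mean of [s - t] over the interval is [- h / 2], and shifting the
    affine function by [d] shifts its mean by [d]. *)
Lemma time_avg_near_affine (t h A z d : R) (G : R -> R) : 0 < h ->
  (forall s, t - h <= s <= t -> `|G s - (A + z * (s - t))| <= d) ->
  `|h^-1 * Rintegral mu [set s | t - h <= s <= t] G - (A - z * h / 2)| <= d.
Proof.
move=> h0 Gd.
have -> : [set s | t - h <= s <= t] = `[t - h, t]%classic.
  by apply/seteqP; split => x; rewrite /= in_itv.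
pose P k s := A + k + z * (s - t).
have cP k : continuous (P k).
  move=> x; apply: cvgD; first exact: cvg_cst.
  apply: cvgM; first exact: cvg_cst.
  by apply: cvgB; [exact: cvg_id|exact: cvg_cst].
have IP k : Rintegral mu `[t - h, t] (P k) = h * (A + k - z * h / 2).
  pose Q (x : R) := 0 + (A + k - z * t) * x + z / 2 * x ^+ 2.
  have dQ (x : R) : is_derive x (1 : R) Q (P k x).
    rewrite (_ : P k x = A + k - z * t + 2 * (z / 2) * x); last by rewrite /P; field.
    exact: is_derive1_quad.
  have cQ : continuous Q.
    by move=> x; have [/derivable1_diffP/differentiable_continuous] := dQ x.
  have th : t - h < t by lra.
  rewrite (Rintegral_FTC2 _ _ _ _ th (cP k) cQ (fun x _ => dQ x)) /Q.
  by field.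
pose B := `|A| + `|d| + `|z| * h.
have PB k s : `|k| <= `|d| -> t - h <= s <= t -> `|P k s| <= B.
  move=> kd /andP[s1 s2]; rewrite /P /B.
  apply: le_trans (ler_normD _ _) _; apply: lerD.
    by apply: le_trans (ler_normD _ _) _; rewrite lerD2l.
  by rewrite normrM ler_wpM2l// ler_norml; apply/andP; split; lra.
have P0 s : P 0 s = A + z * (s - t) by rewrite /P addr0.
have GB s : t - h <= s <= t -> `|G s| <= B + `|d|.
  move=> sh; rewrite -[G s](subrK (P 0 s)) addrC.
  apply: le_trans (ler_normD _ _) (lerD _ _); first by rewrite PB// normr0.
  by rewrite P0; apply: le_trans (Gd s sh) (ler_norm _).
have fin := @lebesgue_measure_itvcc_fin R (t - h) t.
have up : Rintegral mu `[t - h, t] G <= h * (A + d - z * h / 2).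
  rewrite -IP; apply: (@le_Rintegral_bounded _ _ _ _ _ _ _ (B + `|d|) B) => //.
  - by move=> s; rewrite /= in_itv/=; exact: PB.
  - move=> s; rewrite /= in_itv/= => sh; have := Gd s sh; rewrite ler_norml /P => /andP[].
    by lra.
have lo : h * (A - d - z * h / 2) <= Rintegral mu `[t - h, t] G.
  rewrite -IP; apply: (@le_Rintegral_bounded _ _ _ _ _ _ _ B (B + `|d|)) => //.
  - by move=> s; rewrite /= in_itv/=; apply: PB; rewrite normrN.
  - move=> s; rewrite /= in_itv/= => sh; have := Gd s sh; rewrite ler_norml /P => /andP[].
    by lra.
rewrite mulrC ler_norml; apply/andP; split.
  rewrite lerBrDr ler_pdivlMr//; apply: le_trans lo.
  by rewrite le_eqVlt; apply/orP; left; apply/eqP; ring.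
rewrite lerBlDr ler_pdivrMr//; apply: (le_trans up).
by rewrite le_eqVlt; apply/orP; left; apply/eqP; ring.
Qed.

End averages.

(** * Taylor expansion from continuous partial derivatives *)

Section directional_derivatives.
Context {R : realType} {V : normedModType R}.
Implicit Types (f : V -> R) (x v w : V).

Lemma is_derive_line f x v (a df : R) :
  is_derive (x + a *: v) v f df ->
  is_derive a (1 : R) (fun b => f (x + b *: v)) df.
Proof.
move=> [dv <-].
have E : (fun h : R => h^-1 *:
    (((fun b => f (x + b *: v)) \o shift a) (h *: 1) - f (x + a *: v))) =
  (fun h : R => h^-1 *: ((f \o shift (x + a *: v)) (h *: v) - f (x + a *: v))).
  apply/funext => h; rewrite /= /shift; congr (_ *: (f _ - _)).
  by rewrite -[h *: 1]/(h * 1) mulr1 scalerDl addrCA.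
by split; [rewrite /derivable E|rewrite /derive E].
Qed.

(** Bounding only [|k|] treats both signs of [c] at once. *)
Lemma MVT_line f (Df : V -> R) x v (c : R) :
  (forall y, is_derive y v f (Df y)) ->
  exists2 k : R, `|k| <= `|c| & f (x + c *: v) - f x = c * Df (x + k *: v).
Proof.
move=> df; pose g b := f (x + b *: v).
have dg (a : R) : is_derive a (1 : R) g (Df (x + a *: v)) by exact: is_derive_line.
have cg (a b : R) : {within `[a, b], continuous g}.
  by apply: derivable_within_continuous => y _; case: (dg y).
have -> : f x = g 0 by rewrite /g scale0r addr0.
have [c0|c0] := leP 0 c.
  have [k] := @MVT_segment R g (fun a => Df (x + a *: v)) 0 c c0
    (fun y _ => dg y) (cg 0 c).
  rewrite in_itv/= subr0 mulrC => /andP[k0 kc] E; exists k => //.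
  by rewrite !ger0_norm.
have [k] := @MVT_segment R g (fun a => Df (x + a *: v)) c 0 (ltW c0)
  (fun y _ => dg y) (cg c 0).
rewrite in_itv/= => /andP[ck k0] E; exists k.
  by rewrite !ler0_norm ?lerN2// ltW.
by rewrite -opprB E; ring.
Qed.

(** The increment is split into a step along [v] from [x], then one along [w] from [x + h *: v]. The
    mean value theorem turns the second into a value of [Dw] near [x], and continuity of [Dw] gives
    the limit. *)
Lemma is_derive_add_dir f (Dw : V -> R) x v w (c dv : R) :
  is_derive x v f dv -> (forall y, is_derive y w f (Dw y)) ->
  {for x, continuous Dw} ->
  is_derive x (v + c *: w) f (dv + c * Dw x).
Proof.
move=> [dv1 <-] dw cw.
suff cv : (fun h : R => h^-1 *: ((f \o shift x) (h *: (v + c *: w)) - f x)) @ 0^' -->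
    'D_v f x + c * Dw x.
  by split; [apply/cvg_ex; exists ('D_v f x + c * Dw x)|exact: cvg_lim cv].
rewrite (_ : (fun h => _) = (fun h : R => h^-1 *: ((f \o shift x) (h *: v) - f x) +
   h^-1 * (f (x + h *: v + (h * c) *: w) - f (x + h *: v)))); last first.
  apply/funext => h; rewrite /= /shift -![_ *: (_ - _)]/(_ * (_ - _)) -mulrDr.
  rewrite [h *: v + x]addrC; congr (_ * _).
  rewrite scalerDr scalerA [_ + x]addrC addrA; ring.
apply: cvgD; first exact: dv1.
apply/cvgrPdist_le => eps eps0.
have c1 : 0 < 1 + `|c| by rewrite ltr_pwDl.
move/cvgrPdist_le : cw => /(_ (eps / (1 + `|c|)) (divr_gt0 eps0 c1)) /nbhs_normP[de /= de0 H].
(* The intermediate point lies within [|h| * K] of [x]; the added 1 keeps the divisor positive when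
   [K] is 0. *)
pose K := `|v| + `|c| * `|w|.
have K1 : 0 < 1 + K by rewrite ltr_pwDl// addr_ge0// mulr_ge0.
near=> h.
have h0 : h != 0 by near: h; exact: nbhs_dnbhs_neq.
have hde : `|h| < de / (1 + K).
  near: h; apply: nbhs_dnbhs; apply/nbhs_normP; exists (de / (1 + K)); first exact: divr_gt0.
  by move=> y /=; rewrite sub0r normrN.
have [k kh ->] := MVT_line f Dw (x + h *: v) w (h * c) dw.
rewrite -!mulrA mulKf// -mulrBr normrM.
have Hk : `|Dw x - Dw (x + h *: v + k *: w)| <= eps / (1 + `|c|).
  apply: H; rewrite /= -addrA opprD addNKr normrN.
  apply: (@le_lt_trans _ _ (`|h| * K)).
    apply: le_trans (ler_normD _ _) _; rewrite !normrZ /K mulrDr lerD2l mulrA -normrM.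
    by rewrite ler_wpM2r.
  apply: (@le_lt_trans _ _ (`|h| * (1 + K))); first by rewrite ler_wpM2l// lerDr.
  by rewrite -ltr_pdivlMr.
apply: le_trans (ler_wpM2l (normr_ge0 _) Hk) _.
by rewrite mulrA ler_pdivrMr// mulrC ler_wpM2l ?lerDr// ltW.
Unshelve. all: by end_near. Qed.

End directional_derivatives.

Section taylor.
Context {R : realType} {n : nat}.
Implicit Types (f : 'rV[R]_n -> R) (x z : 'rV[R]_n).

(** The direction is assembled from its coordinates one at a time, each adding a multiple of a
    continuous partial derivative. *)
Lemma is_derive_of_partials f (D : 'I_n -> 'rV[R]_n -> R) x z :
  (forall i y, is_derive y (evec i) f (D i y)) -> (forall i, continuous (D i)) ->
  is_derive x z f (\sum_i z 0 i * D i x).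
Proof.
move=> df cD; rewrite {1}[z]row_sum_delta.
elim: (index_enum _) => [|i s IH].
  by rewrite !big_nil; exact: is_derive0.
rewrite !big_cons addrC [X in is_derive _ _ _ X]addrC.
by apply: is_derive_add_dir => //; exact: cD.
Qed.

(** The mean value theorem is used twice along the segment on [f] minus its quadratic model. [M] is
    any matrix close to the second derivatives there, so it can be frozen at another point. *)
Lemma taylor2 f (D : 'I_n -> 'rV[R]_n -> R) (H : 'I_n -> 'I_n -> 'rV[R]_n -> R)
    (M : 'I_n -> 'I_n -> R) x z (eta : R) :
  (forall i y, is_derive y (evec i) f (D i y)) ->
  (forall i j y, is_derive y (evec i) (D j) (H i j y)) ->
  (forall i, continuous (D i)) -> (forall i j, continuous (H i j)) ->
  (forall i j (k : R), `|k| <= 1 -> `|H i j (x + k *: z) - M i j| <= eta) ->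
  `|f (x + z) - (f x + \sum_i D i x * z 0 i +
     \sum_i \sum_j M i j / 2 * z 0 i * z 0 j)| <=
  eta * (\sum_i `|z 0 i|) ^+ 2.
Proof.
move=> df dD cD cH HM.
(* [g1] and [g2] are the first and second derivatives of [f] in the direction [z]. *)
pose g1 y := \sum_i z 0 i * D i y.
pose g2 y := \sum_i z 0 i * \sum_j z 0 j * H j i y.
have df1 y : is_derive y z f (g1 y) by exact: is_derive_of_partials.
have dg1 y : is_derive y z g1 (g2 y).
  rewrite (_ : g1 = \sum_i (z 0 i *: D i)); last first.
    by apply/funext => u; rewrite fct_sumE.
  apply: is_derive_sum => i.
  have di : is_derive y z (D i) (\sum_j z 0 j * H j i y) by exact: is_derive_of_partials.
  exact: is_deriveZ.
pose q := \sum_i \sum_j M i j * z 0 i * z 0 j.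
pose S := (\sum_i `|z 0 i|) ^+ 2.
have g2q (k : R) : `|k| <= 1 -> `|g2 (x + k *: z) - q| <= eta * S.
  move=> k1; rewrite /q exchange_big /= /g2 -sumrB.
  apply: le_trans (ler_norm_sum _ _ _) _.
  rewrite /S expr2 mulrCA big_distrl /=; apply: ler_sum => i _.
  rewrite [X in _ - X](_ : _ = z 0 i * \sum_j z 0 j * M j i); last first.
    by rewrite big_distrr /=; apply: eq_bigr => j _; ring.
  rewrite -mulrBr normrM ler_wpM2l// -sumrB mulrC big_distrl /=.
  apply: le_trans (ler_norm_sum _ _ _) _; apply: ler_sum => j _.
  by rewrite -mulrBr normrM ler_wpM2l// HM.
(* [G] is the Taylor remainder along the segment up to the constant [f x]. Its derivative [G1]
   vanishes at 0 and has the small derivative [g2 - q]. *)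
pose G (a : R) := f (x + a *: z) - (0 + g1 x * a + q / 2 * a ^+ 2).
pose G1 (a : R) := g1 (x + a *: z) - (g1 x + q * a + 0 * a ^+ 2).
have dG (a : R) : is_derive a (1 : R) G (G1 a).
  have E := is_derive1B _ _ _ _ _ (is_derive_line _ _ _ a _ (df1 (x + a *: z)))
    (is_derive1_quad 0 (g1 x) (q / 2) a).
  by rewrite (_ : G1 a = g1 (x + a *: z) - (g1 x + 2 * (q / 2) * a))// /G1; field.
have dG1 (a : R) : is_derive a (1 : R) G1 (g2 (x + a *: z) - q).
  have E := is_derive1B _ _ _ _ _ (is_derive_line _ _ _ a _ (dg1 (x + a *: z)))
    (is_derive1_quad (g1 x) q 0 a).
  by rewrite (_ : _ - q = g2 (x + a *: z) - (q + 2 * 0 * a))//; ring.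
have cG (F F' : R -> R) (a b : R) : (forall a, is_derive a (1 : R) F (F' a)) ->
    {within `[a, b], continuous F}.
  by move=> dF; apply: derivable_within_continuous => y _; case: (dF y).
have [k] := @MVT_segment _ G G1 0 1 ler01 (fun y _ => dG y) (cG _ _ _ _ dG).
rewrite in_itv/= subr0 mulr1 => /andP[k0 k1] E1.
have [k'] := @MVT_segment _ G1 (fun a => g2 (x + a *: z) - q) 0 k k0
  (fun y _ => dG1 y) (cG _ _ _ _ dG1).
rewrite in_itv/= subr0 => /andP[k'0 k'k] E2.
have G10 : G1 0 = 0 by rewrite /G1 scale0r addr0; ring.
have G0 : G 0 = f x by rewrite /G scale0r addr0; ring.
have G1E : G 1 = f (x + z) - (g1 x + q / 2) by rewrite /G scale1r; ring.
rewrite [X in `|X|](_ : _ = G 1 - G 0); last first.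
  rewrite G1E G0 /g1 /q; have -> : \sum_i D i x * z 0 i = \sum_i z 0 i * D i x.
    by apply: eq_bigr => i _; rewrite mulrC.
  have -> : \sum_i \sum_j M i j / 2 * z 0 i * z 0 j =
      (\sum_i \sum_j M i j * z 0 i * z 0 j) / 2.
    rewrite big_distrl /=; apply: eq_bigr => i _; rewrite big_distrl /=.
    by apply: eq_bigr => j _; ring.
  by ring.
move: E2; rewrite G10 subr0 E1 => ->; rewrite normrM -/S.
have k'1 : `|k'| <= 1 by rewrite ger0_norm// (le_trans k'k).
apply: le_trans (g2q k' k'1).
by rewrite ler_piMr// ger0_norm.
Qed.

End taylor.

(** * Expansion of the space-time averages of a test function *)

Section expansion.
Context {R : realType} {n : nat}.
Notation mu := (@lebesgue_measure R).
Implicit Types (phi : 'rV[R]_n -> R -> R) (x z : 'rV[R]_n).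

Lemma continuous_slice (f : 'rV[R]_n * R -> R) (s : R) :
  continuous f -> continuous (fun y => f (y, s)).
Proof.
move=> cf y; apply/(@cvgrPdist_le _ _ _ (nbhs y) (nbhs_filter y)) => e e0.
have /cvgrPdist_le/(_ e e0)/nbhs_ballP[de /= de0 H] := cf (y, s).
apply/nbhs_ballP; exists de => // z yz.
by apply: (H (z, s)); split => //=; exact: ballxx.
Qed.

(** Joint continuity of the second derivatives lets them be frozen at time [t], uniformly for [s]
    near [t]. The gradient may stay at time [s], since linear terms average to zero over balls. *)
Lemma C21_taylor_space phi x t (eta : R) : C21 phi -> 0 < eta ->
  exists2 de : R, 0 < de & forall z s, `|z| < de -> `|s - t| < de ->
    `|phi (x + z) s - (phi x s + \sum_i dx i phi x s * z 0 i +
       \sum_i \sum_j D2 phi x t i j / 2 * z 0 i * z 0 j)| <=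
    eta * (\sum_i `|z 0 i|) ^+ 2.
Proof.
move=> [_ [d1 [d2 [_ [c1 [c2 _]]]]]] eta0.
have : \forall p \near (x, t), forall i j,
    `|dx i (dx j phi) x t - dx i (dx j phi) p.1 p.2| <= eta.
  have nF := nbhs_filter (x, t).
  apply: (filter_forall nF) => i; apply: (filter_forall nF) => j.
  by have /cvgrPdist_le/(_ eta eta0) := c2 i j (x, t).
move=> /nbhs_ballP[de /= de0 H]; exists de => // z s zde sde.
apply: (@taylor2 _ _ (fun y => phi y s) (fun i y => dx i phi y s)
  (fun i j y => dx i (dx j phi) y s)).
- by move=> i y; apply: DeriveDef => //; exact: d1.
- by move=> i j y; apply: DeriveDef => //; exact: d2.
- by move=> i; exact: (continuous_slice (fun p => dx i phi p.1 p.2)).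
- by move=> i j; exact: (continuous_slice (fun p => dx i (dx j phi) p.1 p.2)).
move=> i j k k1; rewrite [D2 _ _ _ _ _]mxE distrC.
apply: (H (x + k *: z, s)); split => /=; rewrite -ball_normE /=.
  rewrite opprD addNKr normrN normrZ; apply: le_lt_trans zde.
  by rewrite ler_piMl.
by rewrite distrC.
Qed.

Lemma C21_taylor_time phi x t (eta : R) : C21 phi -> 0 < eta ->
  exists2 de : R, 0 < de & forall s, `|s - t| < de ->
    `|phi x s - (phi x t + dt phi x t * (s - t))| <= eta * `|s - t|.
Proof.
move=> [_ [_ [_ [d _]]]] eta0; have dxt := d x t.
have /cvgrPdist_le/(_ eta eta0) :
    (fun h : R => h^-1 *: ((phi x \o shift t) (h *: 1) - phi x t)) @ 0^' -->
    dt phi x t.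
  exact: dxt.
move=> /nbhs_normP[de /= de0 H]; exists de => // s sde.
have [->|st] := eqVneq s t; first by rewrite subrr normr0 !mulr0 addr0 subrr normr0.
have st0 : s - t != 0 by rewrite subr_eq0.
have {H} := H (s - t); rewrite /= sub0r normrN => /(_ sde st0).
rewrite -![_ *: _]/(_ * _) mulr1 subrK => H.
rewrite -ler_pdivrMr ?normr_gt0// -normfV -normrM.
apply: le_trans H; rewrite distrC le_eqVlt; apply/orP; left; apply/eqP.
by congr `|_|; field.
Qed.

(** A single [de] serves all pairs bounded by [C]; this uniformity is what lets the estimate pass
    through the sup-inf. *)
Lemma average_expansion phi x t (C eta : R) : C21 phi -> 0 <= C -> 0 < eta ->
  exists2 de : R, 0 < de & forall (e : R) (A : 'M[R]_n) (b : R),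
    0 < e < de -> (forall i j, `|A i j| <= C) -> 0 < b <= C ->
    let h := b / (n%:R + 2) * e ^+ 2 in
    `|h^-1 * Rintegral mu [set s | t - h <= s <= t]
          (fun s => ballavg e (fun y => phi (x + y *m A^T) s)) -
      (phi x t + e ^+ 2 / (2 * (n%:R + 2)) *
         (\tr (A^T *m D2 phi x t *m A) - b * dt phi x t))| <= eta * e ^+ 2.
Proof.
move=> Cphi C0 eta0.
pose N : R := n%:R; have N0 : 0 <= N by rewrite ler0n.
(* The spatial error carries the factor [(N * (N * C)) ^+ 2] and the time error the factor [C]; the
   1 keeps [L] positive. *)
pose L := (N * (N * C)) ^+ 2 + C + 1.
have L0 : 0 < L by rewrite ltr_wpDl// addr_ge0// sqr_ge0.
have eL0 : 0 < eta / L by rewrite divr_gt0.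
have [d1 d10 H1] := C21_taylor_space phi x t (eta / L) Cphi eL0.
have [d2 d20 H2] := C21_taylor_time phi x t (eta / L) Cphi eL0.
pose d0 := Num.min d1 d2.
have d00 : 0 < d0 by rewrite lt_min d10.
have P0 : 0 < N * C + C + 1 by rewrite ltr_wpDl// addr_ge0// mulr_ge0.
(* For [e < 1], both the bound [N * C * e] on the spatial displacement and the bound [C * e ^+ 2] on
   the time step fall below [d0]. *)
exists (Num.min 1 (d0 / (N * C + C + 1))).
  by rewrite lt_min ltr01 divr_gt0.
move=> e A b /andP[e0]; rewrite lt_min => /andP[e1 ed] AC /andP[b0 bC] /=.
set h := b / (n%:R + 2) * e ^+ 2.
rewrite ltr_pdivlMr// in ed.
have NCe : N * C * e < d0 by have := mulr_ge0 N0 C0; nra.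
have Ce : C * e ^+ 2 < d0 by have := mulr_ge0 N0 C0; nra.
have hC : h <= C * e ^+ 2.
  rewrite /h ler_wpM2r ?sqr_ge0// ler_pdivrMr; last by rewrite -/N; lra.
  by rewrite -/N; nra.
have h0 : 0 < h by rewrite /h mulr_gt0 ?exprn_gt0// divr_gt0// -/N; lra.
pose A0 := phi x t + \tr (A^T *m D2 phi x t *m A) / 2 * (e ^+ 2 / (n%:R + 2)).
rewrite [X in `|_ - X|](_ : _ = A0 - dt phi x t * h / 2); last first.
  by rewrite /A0 /h; field; rewrite -/N; lra.
apply: time_avg_near_affine => // s /andP[s1 s2].
have sth : `|s - t| <= h by rewrite ler0_norm; lra.
have std : `|s - t| < d0 by apply: le_lt_trans sth (le_lt_trans hC Ce).
move: (std); rewrite lt_min => /andP[std1 std2].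
have T := H2 s std2.
pose q i j := (A^T *m D2 phi x t *m A) i j / 2.
have trq : \sum_i q i i = \tr (A^T *m D2 phi x t *m A) / 2.
  by rewrite /q -mulr_suml.
(* The ball average at a fixed time [s]: in the variable [y], the quadratic part has matrix
   [A^T *m D2 phi x t *m A] halved, and only its trace survives. *)
have B : `|ballavg e (fun y => phi (x + y *m A^T) s) -
    (phi x s + (\sum_i q i i) * (e ^+ 2 / (n%:R + 2)))| <= eta / L * (N * (N * C * e)) ^+ 2.
  apply: (@ballavg_near_quadpoly _ _ _ _ _ (fun i => \sum_k dx k phi x s * A k i)) => //.
  move=> y ye; set z := y *m A^T.
  have zE i : z 0 i = \sum_k y 0 k * A i k.
    by rewrite /z mxE; apply: eq_bigr => k _; rewrite mxE.
  have zi i : `|z 0 i| <= N * C * e.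
    rewrite zE; apply: le_trans (ler_norm_sum _ _ _) _.
    apply: (@le_trans _ _ (\sum_(k < n) C * e)).
      apply: ler_sum => k _; rewrite normrM mulrC ler_pM//.
      exact/ltW/sum_sqr_lt_coord.
    by rewrite sumr_const card_ord -[leLHS]mulr_natl mulrA.
  have NCe0 : 0 <= N * C * e by rewrite !mulr_ge0// ltW.
  have zd : `|z| < d1.
    apply: (@le_lt_trans _ _ (N * C * e)).
      by rewrite -[`|z|]/(mx_norm z) mx_normrE; apply: bigmax_le => // -[i j] _; rewrite ord1.
    by apply: lt_le_trans NCe _; rewrite ge_min lexx.
  have zS : (\sum_i `|z 0 i|) ^+ 2 <= (N * (N * C * e)) ^+ 2.
    rewrite ler_sqr ?nnegrE; [|by apply: sumr_ge0|exact: mulr_ge0].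
    apply: (@le_trans _ _ (\sum_(k < n) N * C * e)); first by apply: ler_sum => i _; exact: zi.
    by rewrite sumr_const card_ord -[leLHS]mulr_natl.
  rewrite (_ : quadpoly _ _ _ _ _ = phi x s + \sum_i dx i phi x s * z 0 i +
       \sum_i \sum_j D2 phi x t i j / 2 * z 0 i * z 0 j).
    by apply: le_trans (H1 z s zd std1) _; rewrite ler_wpM2l// ltW.
  rewrite /quadpoly; congr (_ + _ + _).
    under eq_bigr do rewrite big_distrl /=.
    rewrite exchange_big /=; apply: eq_bigr => i _.
    by rewrite zE big_distrr /=; apply: eq_bigr => k _; ring.
  have -> : \sum_i \sum_j q i j * y 0 i * y 0 j =
      (y *m (A^T *m D2 phi x t *m A) *m y^T) 0 0 / 2.
    rewrite mxE mulr_suml exchange_big /=; apply: eq_bigr => j _.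
    rewrite !mxE !mulr_suml; apply: eq_bigr => i _.
    by rewrite /q; ring.
  have -> : \sum_i \sum_j D2 phi x t i j / 2 * z 0 i * z 0 j =
      (z *m D2 phi x t *m z^T) 0 0 / 2.
    rewrite mxE mulr_suml exchange_big /=; apply: eq_bigr => j _.
    rewrite !mxE !mulr_suml; apply: eq_bigr => i _.
    by ring.
  by rewrite /z trmx_mul trmxK !mulmxA.
rewrite trq in B.
apply: (@le_trans _ _ (eta / L * (N * (N * C * e)) ^+ 2 + eta / L * `|s - t|)).
  apply: le_trans (lerD B T); apply: le_trans (ler_normD _ _).
  by rewrite /A0 le_eqVlt; apply/orP; left; apply/eqP; congr `|_|; ring.
rewrite -mulrDr mulrAC ler_pdivrMr// -[leRHS]mulrA ler_wpM2l ?(ltW eta0)//.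
apply: (@le_trans _ _ ((N * (N * C * e)) ^+ 2 + C * e ^+ 2)).
  by rewrite lerD2l (le_trans sth).
rewrite /L (_ : (N * (N * C * e)) ^+ 2 = (N * (N * C)) ^+ 2 * e ^+ 2); last by ring.
by rewrite -mulrDl mulrC ler_wpM2l ?sqr_ge0// lerDl.
Qed.

End expansion.

(** * Stability of sup-inf *)

Section supinf.
Context {R : realType} {T : Type}.

(** [Fop] and [Meps] both unfold to this form over [AA x t], so one comparison of the inner
    expressions covers them. *)
Definition supinf (AA : set (set T)) (X : T -> R) : R :=
  sup [set inf [set X p | p in B] | B in AA].

(** The bounds and nonemptiness make every real [sup] and [inf] genuine, as these default to 0
    otherwise; an increasing affine map then commutes with both. *)
Lemma supinf_le_affine (AA : set (set T)) (X Y : T -> R) (c k KX KY : R) :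
  AA !=set0 -> (forall B, AA B -> B !=set0) -> 0 < k ->
  (forall B p, AA B -> B p -> `|X p| <= KX) ->
  (forall B p, AA B -> B p -> `|Y p| <= KY) ->
  (forall B p, AA B -> B p -> X p <= c + k * Y p) ->
  supinf AA X <= c + k * supinf AA Y.
Proof.
move=> AA0 B0 k0 XK YK XY.
have infK (Z : T -> R) K : (forall B p, AA B -> B p -> `|Z p| <= K) ->
    forall B p, AA B -> B p -> inf [set Z p | p in B] <= Z p.
  move=> ZK B p AB Bp; apply: ge_inf; last by exists p.
  by exists (- K) => _ [q Bq <-]; have := ZK B q AB Bq; rewrite ler_norml => /andP[].
apply: ge_sup; first by case: AA0 => B AB; exists (inf [set X p | p in B]); exists B.
move=> _ [B AB <-]; rewrite -lerBlDl -ler_pdivrMl//.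
apply: (@le_trans _ _ (inf [set Y p | p in B])); last first.
  apply: ub_le_sup; last by exists B.
  exists KY => _ [B' AB' <-]; have [p Bp] := B0 _ AB'.
  apply: le_trans (infK _ _ YK B' p AB' Bp) _.
  exact: le_trans (ler_norm _) (YK B' p AB' Bp).
have [p0 Bp0] := B0 _ AB.
apply: lb_le_inf; first by exists (Y p0); exists p0.
move=> _ [p Bp <-]; rewrite ler_pdivrMl// lerBlDl.
exact: le_trans (infK _ _ XK B p AB Bp) (XY B p AB Bp).
Qed.

Lemma supinf_near_affine (AA : set (set T)) (X Y : T -> R) (c k d KY : R) :
  AA !=set0 -> (forall B, AA B -> B !=set0) -> 0 < k ->
  (forall B p, AA B -> B p -> `|Y p| <= KY) ->
  (forall B p, AA B -> B p -> `|X p - (c + k * Y p)| <= d) ->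
  `|supinf AA X - (c + k * supinf AA Y)| <= d.
Proof.
move=> AA0 B0 k0 YK XY.
have XK B p : AA B -> B p -> `|X p| <= d + (`|c| + k * KY).
  move=> AB Bp; rewrite -[X p](subrK (c + k * Y p)).
  apply: le_trans (ler_normD _ _) (lerD (XY B p AB Bp) _).
  apply: le_trans (ler_normD _ _) _; rewrite lerD2l normrM gtr0_norm//.
  by rewrite ler_pM2l// (YK B).
rewrite ler_norml; apply/andP; split.
  (* The lower bound is the upper bound for the inverse affine map, with [X] and [Y] exchanged. *)
  have : supinf AA Y <= k^-1 * (d - c) + k^-1 * supinf AA X.
    apply: (@supinf_le_affine _ _ _ _ _ KY _ AA0 B0 _ YK XK); first by rewrite invr_gt0.
    move=> B p AB Bp; rewrite -mulrDr ler_pdivlMl//.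
    by have := XY B p AB Bp; rewrite ler_norml => /andP[]; lra.
  by rewrite -mulrDr ler_pdivlMl//; lra.
rewrite lerBlDr addrA.
apply: (@supinf_le_affine _ _ _ _ _ _ KY AA0 B0 k0 XK YK) => B p AB Bp.
by have := XY B p AB Bp; rewrite ler_norml => /andP[]; lra.
Qed.

End supinf.

(** * The limit of the rescaled operator and the equivalence *)

Lemma normr_mxtrace_conj_le {R : realType} {n : nat} (A M : 'M[R]_n) (C : R) :
  (forall i j, `|A i j| <= C) ->
  `|\tr (A^T *m M *m A)| <= \sum_(i < n) \sum_k (\sum_j C * `|M j k|) * C.
Proof.
move=> AC; rewrite /mxtrace; apply: le_trans (ler_norm_sum _ _ _) _.
apply: ler_sum => i _; rewrite mxE; apply: le_trans (ler_norm_sum _ _ _) _.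
apply: ler_sum => k _; rewrite normrM ler_pM//.
rewrite mxE; apply: le_trans (ler_norm_sum _ _ _) _.
by apply: ler_sum => j _; rewrite normrM mxE ler_wpM2r.
Qed.

(** Each inner average is within [eta * e ^+ 2] of one affine image of the expression inside [Fop],
    of slope [e ^+ 2 / (2 * (n%:R + 2))]. Sup-inf stability carries this to [Meps], and dividing by
    [e ^+ 2] gives the limit. *)
Lemma Meps_expansion {R : realType} {n : nat}
    (AA : 'rV[R]_n -> R -> set (set ('M[R]_n * R))) phi x t (C : R) :
  AA x t !=set0 -> (forall B, AA x t B -> B !=set0) ->
  (forall B p, AA x t B -> B p -> 0 < p.2) ->
  (forall B p, AA x t B -> B p ->
     (forall i j, `|p.1 i j| <= C) /\ `|p.2| <= C) ->
  C21 phi ->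
  (fun e => (Meps AA phi x t e - phi x t) / e ^+ 2) @ (0 : R)^'+ -->
    Fop AA x t (dt phi x t) (D2 phi x t) / (2 * (n%:R + 2)).
Proof.
move=> AA0 B0 pos bnd Cphi.
have C0 : 0 <= C.
  case: AA0 => B AB; have [p Bp] := B0 B AB.
  by have [_] := bnd B p AB Bp; apply: le_trans.
have n2 : 0 < n%:R + 2 :> R by rewrite ltr_wpDl.
apply/cvgrPdist_le => eta eta0.
have [de de0 H] := average_expansion phi x t C eta Cphi C0 eta0.
near=> e.
have e0 : 0 < e by near: e; exact: nbhs_right_gt.
have ede : e < de by near: e; exact: nbhs_right_lt.
have e2 : 0 < e ^+ 2 by rewrite exprn_gt0.
pose k : R := e ^+ 2 / (2 * (n%:R + 2)).
have k0 : 0 < k by rewrite divr_gt0// mulr_gt0.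
pose Y (p : 'M[R]_n * R) := \tr (p.1^T *m D2 phi x t *m p.1) - p.2 * dt phi x t.
pose KY := \sum_(i < n) \sum_k (\sum_j C * `|D2 phi x t j k|) * C + C * `|dt phi x t|.
have YK B p : AA x t B -> B p -> `|Y p| <= KY.
  move=> AB Bp; have [pC p2C] := bnd B p AB Bp.
  apply: le_trans (ler_normB _ _) (lerD _ _).
    exact: normr_mxtrace_conj_le.
  by rewrite normrM ler_wpM2r.
have near_affine : `|Meps AA phi x t e -
    (phi x t + k * Fop AA x t (dt phi x t) (D2 phi x t))| <=
    eta * e ^+ 2.
  apply: (@supinf_near_affine _ _ _ _ Y _ _ _ KY AA0 B0 k0 YK) => B p AB Bp.
  have [pC p2C] := bnd B p AB Bp.
  apply: H; rewrite ?e0// (pos B)//.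
  exact: le_trans (ler_norm _) p2C.
rewrite -(ler_pM2r e2); apply: le_trans near_affine.
rewrite -{2}(gtr0_norm e2) -normrM distrC le_eqVlt; apply/orP; left; apply/eqP.
congr `|_|; rewrite /k; field.
by rewrite (gt_eqF e0) (gt_eqF n2).
Unshelve. all: by end_near. Qed.

(** The positive part is 1-Lipschitz and commutes with division by [e ^+ 2], so the quotient tends
    to [Num.max L 0]; uniqueness of limits gives the equivalence. *)
Lemma cvg_pos_part_div {R : realType} (D : R -> R) (L : R) :
  (fun e => D e / e ^+ 2) @ (0 : R)^'+ --> L ->
  (fun e => Num.max (D e) 0 / e ^+ 2) @ (0 : R)^'+ --> (0 : R) <-> L <= 0.
Proof.
move=> DL.
have DM : (fun e => Num.max (D e) 0 / e ^+ 2) @ (0 : R)^'+ --> Num.max L 0.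
  rewrite (_ : (fun e => _) = (fun e => Num.max (D e / e ^+ 2) 0)).
    apply/cvgrPdist_le => eta eta0; move/cvgrPdist_le : DL => /(_ eta eta0).
    apply: filterS => e /=; set a := D e / _; apply: le_trans.
    rewrite ler_norml; have := lexx `|L - a|; rewrite {1}ler_norml.
    by case: (leP L 0); case: (leP a 0) => ? ? /andP[? ?]; apply/andP; split; lra.
  by apply/funext => e; rewrite maxr_pMl ?invr_ge0 ?sqr_ge0// mul0r.
split => [D0|L0].
  by have <- : Num.max L 0 = 0; [exact: cvg_unique DM D0|rewrite le_max lexx].
by move: DM; rewrite (max_idPr L0).
Qed.

Theorem theorem2p9 (R : realType) (n : nat) (Om : set 'rV[R]_n) (t1 t2 : R)
    (AA : 'rV[R]_n -> R -> set (set ('M[R]_n * R)))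
    (u : 'rV[R]_n -> R -> R) :
  open Om -> t1 < t2 ->
  (forall x t, in_dom Om t1 t2 x t ->
     AA x t !=set0 /\
     (forall Aset, AA x t Aset -> Aset !=set0) /\
     (forall Aset p, AA x t Aset -> Aset p -> psd p.1 /\ 0 < p.2)) ->
  (forall x t, in_dom Om t1 t2 x t ->
     exists C : R, forall Aset p, AA x t Aset -> Aset p ->
       (forall i j, `|p.1 i j| <= C) /\ `|p.2| <= C) ->
  {within [set p : 'rV[R]_n * R | in_dom Om t1 t2 p.1 p.2],
     continuous (fun p => u p.1 p.2)} ->
  (viscosity_solution (Fop AA) Om t1 t2 u <->
   asymptotic_viscosity AA Om t1 t2 u).
Proof.
move=> _ _ AAne AAbnd cu.
have n2 : 0 < 2 * (n%:R + 2) :> R by rewrite mulr_gt0// ltr_wpDl.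
(* Both notions use the same test functions and contact points, so it suffices to compare the
   inequalities for each [phi] separately. *)
have equiv x t phi : in_dom Om t1 t2 x t -> C21 phi ->
    ((fun e => Num.max (Meps AA phi x t e - phi x t) 0 / e ^+ 2)
       @ (0 : R)^'+ --> (0 : R) <-> Fop AA x t (dt phi x t) (D2 phi x t) <= 0) /\
    ((fun e => Num.max (phi x t - Meps AA phi x t e) 0 / e ^+ 2)
       @ (0 : R)^'+ --> (0 : R) <-> 0 <= Fop AA x t (dt phi x t) (D2 phi x t)).
  move=> xt Cphi; have [AA0 [B0 pos]] := AAne x t xt; have [C bnd] := AAbnd x t xt.
  have pos' B p AB Bp := (pos B p AB Bp).2.
  have cM := Meps_expansion AA phi x t C AA0 B0 pos' bnd Cphi.
  split; first by rewrite (cvg_pos_part_div _ _ cM) pmulr_lle0// invr_gt0.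
  have cM' : (fun e => (phi x t - Meps AA phi x t e) / e ^+ 2) @ (0 : R)^'+ -->
      - (Fop AA x t (dt phi x t) (D2 phi x t) / (2 * (n%:R + 2))).
    rewrite (_ : (fun e => _) = (fun e => - ((Meps AA phi x t e - phi x t) / e ^+ 2))).
      exact: cvgN.
    by apply/funext => e; rewrite -mulNr opprB.
  by rewrite (cvg_pos_part_div _ _ cM') oppr_le0 pmulr_lge0// invr_gt0.
split=> [[_ vis]|asy].
  move=> x t xt phi Cphi; have [ei es] := equiv x t phi xt Cphi.
  have [vmax vmin] := vis x t xt phi Cphi.
  by split=> ext E; [apply/ei; exact: vmin|apply/es; exact: vmax].
split=> // x t xt phi Cphi; have [ei es] := equiv x t phi xt Cphi.
have [vmin vmax] := asy x t xt phi Cphi.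
by split=> ext E; [apply/es; exact: vmax|apply/ei; exact: vmin].
Qed.
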